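(* Let $m$ be a positive integer and let $A=[a_{ij}]_{1\le i,j\le 2m}$ be a skew-symmetric matrix of even order over a commutative ring such that $a_{ij}=0$ whenever $i+j\in\{2q:\ q=2,3,\ldots\}$. Then $$\mathrm{per}(A)=(-1)^m\left(\mathrm{per}[a_{2i,2j-1}]_{1\le i,j\le m}\right)^2$$ and $$\det(A)=\left(\det[a_{2i,2j-1}]_{1\le i,j\le m}\right)^2.$$
   Context: A matrix $A=[a_{ij}]_{1\le i,j\le n}$ over a commutative ring is called skew-symmetric if $a_{ji}=-a_{ij}$ for all $i,j=1,\ldots,n$ (no further condition is imposed on the diagonal). For an $n\times n$ matrix $A=[a_{i,j}]_{1\le i,j\le n}$ over a commutative ring, $\det(A)=\sum_{\sigma\in S_n}\mathrm{sign}(\sigma)\prod_{i=1}^n a_{i,\sigma(i)}$ is the determinant and $\mathrm{per}(A)=\sum_{\sigma\in S_n}\prod_{i=1}^n a_{i,\sigma(i)}$ is the permanent, where $S_n$ is the symmetric group on $\{1,\ldots,n\}$. *)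

(* Defs.v *)
From mathcomp Require Import all_boot all_order all_fingroup all_algebra.

Set Implicit Arguments.
Unset Strict Implicit.
Unset Printing Implicit Defensive.

Import GRing.Theory.
Local Open Scope ring_scope.

Definition permanent (R : comPzRingType) (n : nat) (A : 'M[R]_n) : R :=
  \sum_(s : 'S_n) \prod_(i < n) A i (s i).

(* The diagonal entries are only required to satisfy a = - a, so they need not
   vanish when 2 is a zero divisor. *)
Definition skew_symmetric (R : comPzRingType) (n : nat) (A : 'M[R]_n) : Prop :=
  forall i j : 'I_n, A j i = - A i j.

Lemma even_pos_subproof (m : nat) (i : 'I_m) : ((2 * i).+1 < 2 * m)%N.
Proof. by rewrite !mul2n ltn_Sdouble. Qed.

Lemma odd_pos_subproof (m : nat) (j : 'I_m) : (2 * j < 2 * m)%N.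
Proof. by rewrite ltn_mul2l /=. Qed.

(* Ordinals count from 0, so the 1-based index k is the ordinal k - 1.  Thus
   for the 1-based indices i.+1 and j.+1, the 1-based indices 2 * i.+1 and
   2 * j.+1 - 1 are the ordinals 2 * i + 1 and 2 * j. *)
Definition even_pos (m : nat) (i : 'I_m) : 'I_(2 * m) :=
  Ordinal (even_pos_subproof i).

Definition odd_pos (m : nat) (j : 'I_m) : 'I_(2 * m) :=
  Ordinal (odd_pos_subproof j).

(* [a_{2i,2j-1}]_{1 <= i,j <= m} *)
Definition even_odd_submx (R : comPzRingType) (m : nat) (A : 'M[R]_(2 * m)) :
  'M[R]_m := \matrix_(i < m, j < m) A (even_pos i) (odd_pos j).

(* Main.v *)
Require Import Defs.
From mathcomp Require Import all_boot all_order all_fingroup all_algebra.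

Import GRing.Theory.
Local Open Scope ring_scope.

(** Listing the odd indices before the even ones turns [A] into a block matrix
    [[X, - C^T], [C, 0]] with [C = [a_{2i,2j-1}]].  Exchanging the two block
    columns makes it block triangular, whence [per A = per (- C^T) * per C];
    for the determinant, [- C^T] picks up a sign during the exchange, and
    [det A = det C^T * det C].  The odd-odd block [X], hence the entry [a_{11}]
    (which need not vanish), is irrelevant. *)

Lemma permanent_tr (R : comPzRingType) (n : nat) (A : 'M[R]_n) :
  permanent A^T = permanent A.
Proof.
rewrite /permanent [RHS](reindex_inj invg_inj) /=.
apply: eq_bigr => s _.
rewrite [RHS](reindex_inj (@perm_inj _ s)) /=.
by apply: eq_bigr => i _; rewrite mxE permK.
Qed.

Lemma permanentZ (R : comPzRingType) (n : nat) (a : R) (A : 'M[R]_n) :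
  permanent (a *: A) = a ^+ n * permanent A.
Proof.
rewrite /permanent big_distrr /=; apply: eq_bigr => s _.
under eq_bigr do rewrite mxE.
by rewrite big_split /= prodr_const card_ord.
Qed.

(** Permuting rows and columns independently only reindexes the sum over permutations. The
    dimensions are related by an equation because [m + m] and [2 * m] are not convertible. *)
Lemma permanent_mxsub (R : comPzRingType) (n k : nat) (f g : 'I_n -> 'I_k)
    (A : 'M[R]_k) :
  n = k -> injective f -> injective g -> permanent (mxsub f g A) = permanent A.
Proof.
move=> eq_nk; case: k / eq_nk f g A => f g A injf injg.
rewrite /permanent.
rewrite (reindex (fun s => perm injf * s * (perm injg)^-1)%g) /=; last first.
  exists (fun s => (perm injf)^-1 * s * perm injg)%g => s _.
    by rewrite !mulgA mulVg mul1g mulgKV.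
  by rewrite !mulgA mulgV mul1g mulgK.
apply: eq_bigr => s _.
rewrite [RHS](reindex_inj injf) /=; apply: eq_bigr => i _.
by rewrite mxE !permM (permE injf) -(permE injg) permKV.
Qed.

(** Rows and columns share one reordering, so its sign occurs twice and cancels. *)
Lemma det_mxsub (R : comPzRingType) (n k : nat) (f : 'I_n -> 'I_k)
    (A : 'M[R]_k) :
  n = k -> injective f -> \det (mxsub f f A) = \det A.
Proof.
move=> eq_nk; case: k / eq_nk f A => f A injf.
have -> : mxsub f f A = row_perm (perm injf) (col_perm (perm injf) A).
  by apply/matrixP => i j; rewrite !mxE !permE.
rewrite row_permE col_permE !det_mulmx det_perm mulrCA det_perm odd_permV.
by rewrite -signr_addb addbb mulr1.
Qed.

Definition block_fun (n1 n2 : nat) (s1 : 'I_n1 -> 'I_n1) (s2 : 'I_n2 -> 'I_n2)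
    (i : 'I_(n1 + n2)) : 'I_(n1 + n2) :=
  match split i with
  | inl j => lshift n2 (s1 j)
  | inr j => rshift n1 (s2 j)
  end.

Lemma block_fun_lshift (n1 n2 : nat) (s1 : 'I_n1 -> 'I_n1)
    (s2 : 'I_n2 -> 'I_n2) (i : 'I_n1) :
  block_fun n1 n2 s1 s2 (lshift n2 i) = lshift n2 (s1 i).
Proof. by rewrite /block_fun (unsplitK (inl i)). Qed.

Lemma block_fun_rshift (n1 n2 : nat) (s1 : 'I_n1 -> 'I_n1)
    (s2 : 'I_n2 -> 'I_n2) (i : 'I_n2) :
  block_fun n1 n2 s1 s2 (rshift n1 i) = rshift n1 (s2 i).
Proof. by rewrite /block_fun (unsplitK (inr i)). Qed.

Lemma block_fun_inj (n1 n2 : nat) (s : 'S_n1 * 'S_n2) :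
  injective (block_fun n1 n2 s.1 s.2).
Proof.
apply: (can_inj (g := block_fun n1 n2 s.1^-1%g s.2^-1%g)) => i.
case: (split_ordP i) => j ->.
  by rewrite !block_fun_lshift permK.
by rewrite !block_fun_rshift permK.
Qed.

Definition block_perm (n1 n2 : nat) (s : 'S_n1 * 'S_n2) : 'S_(n1 + n2) :=
  perm (block_fun_inj n1 n2 s).

Lemma block_perm_inj (n1 n2 : nat) : injective (block_perm n1 n2).
Proof.
move=> [s1 s2] [t1 t2] /permP eq_st; congr pair; apply/permP => i.
  move: (eq_st (lshift n2 i)); rewrite !permE !block_fun_lshift.
  exact: lshift_inj.
move: (eq_st (rshift n1 i)); rewrite !permE !block_fun_rshift.
exact: rshift_inj.
Qed.

(** By finiteness [s] maps the right block onto itself, so injectivity keeps the left block out of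
    it. *)
Lemma block_permP (n1 n2 : nat) (s : 'S_(n1 + n2)) :
  (forall i, exists j, s (rshift n1 i) = rshift n1 j) ->
  exists t, s = block_perm n1 n2 t.
Proof.
move=> sr.
(* The default [i] only makes the function total; [sr2] shows that it is never reached. *)
pose f2 i := if split (s (rshift n1 i)) is inr j then j else i.
have sr2 i : s (rshift n1 i) = rshift n1 (f2 i).
  by rewrite /f2; have [j ->] := sr i; rewrite (unsplitK (inr j)).
have f2_inj : injective f2.
  by move=> i j eq_f; apply/(@rshift_inj n1)/(@perm_inj _ s); rewrite !sr2 eq_f.
pose f1 i := if split (s (lshift n2 i)) is inl j then j else i.
have sl1 i : s (lshift n2 i) = lshift n2 (f1 i).
  rewrite /f1; case: (split_ordP (s (lshift n2 i))) => // j Ej.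
  (* If [s] sent a left index to the right index [j], that value would also be attained at the right
     index [g j]. *)
  have [g _ gK] := injF_bij f2_inj.
  have /perm_inj/eqP : s (lshift n2 i) = s (rshift n1 (g j)).
    by rewrite sr2 gK.
  by rewrite eq_lrshift.
have f1_inj : injective f1.
  by move=> i j eq_f; apply/(@lshift_inj _ n2)/(@perm_inj _ s); rewrite !sl1 eq_f.
exists (perm f1_inj, perm f2_inj); apply/permP => i; rewrite permE.
case: (split_ordP i) => j ->.
  by rewrite block_fun_lshift permE.
by rewrite block_fun_rshift permE.
Qed.

(** Only block permutations contribute: any other one sends some right index to a left one and so
    picks an entry of the zero block. *)
Lemma permanent_ublock (R : comPzRingType) (n1 n2 : nat)
    (P : 'M[R]_n1) (X : 'M[R]_(n1, n2)) (Q : 'M[R]_n2) :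
  permanent (block_mx P X 0 Q) = permanent P * permanent Q.
Proof.
rewrite /permanent big_distrlr pair_big /=.
rewrite (bigID (mem (codom (block_perm n1 n2)))) /= [X in _ + X]big1 ?addr0.
  rewrite -big_uniq /=; last first.
    by rewrite (map_inj_uniq (@block_perm_inj _ _)) enum_uniq.
  rewrite /codom /image_mem big_map big_enum /=; apply: eq_bigr => s _.
  rewrite big_split_ord /=; congr (_ * _); apply: eq_bigr => i _.
    by rewrite permE block_fun_lshift block_mxEul.
  by rewrite permE block_fun_rshift block_mxEdr.
move=> s notin_s.
have [i Hi] : exists i, [forall j, s (rshift n1 i) != rshift n1 j].
  apply/existsP; apply: contraR notin_s => /existsPn Hs.
  have [i|t ->] := block_permP n1 n2 s; last exact: codom_f.
  have /forallPn[j] := Hs i.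
  by rewrite negbK => /eqP; exists j.
rewrite (bigD1 (rshift n1 i)) //=.
case: (split_ordP (s (rshift n1 i))) Hi => j -> Hi.
  by rewrite block_mxEdl mxE mul0r.
by have /forallP/(_ j)/eqP := Hi.
Qed.

Lemma det_antiblock (R : comPzRingType) (n : nat) (X B C : 'M[R]_n) :
  \det (block_mx X B C 0) = \det (- B) * \det C.
Proof.
(* The exchange matrix, factored into transvections so that its determinant is
   visibly 1. *)
pose U : 'M[R]_(n + n) := block_mx 1%:M 1%:M 0 1%:M.
pose L : 'M[R]_(n + n) := block_mx 1%:M 0 (- 1%:M) 1%:M.
rewrite -(det_ublock _ X).
(* [U *m L *m U] sends block columns [(P, Q)] to [(- Q, P)]; a plain swap would have determinant
   [(-1) ^+ n]. *)
have <- : block_mx X B C 0 *m (U *m L *m U) = block_mx (- B) X 0 C.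
  rewrite /U /L !mulmx_block !(mul1mx, mulmx1, mul0mx, mulmx0, mulmxN).
  by rewrite !(add0r, addr0, subrr, addNr, mulmx0, mulmx1, mulmxN, oppr0).
by rewrite !det_mulmx det_ublock det_lblock !det1 !mulr1.
Qed.

Definition odd_even_pos (m : nat) (i : 'I_(m + m)) : 'I_(2 * m) :=
  match split i with inl j => odd_pos j | inr j => even_pos j end.

(** Taking columns in this order and rows in the order [odd_even_pos] builds in the exchange of
    block columns, which is free for the permanent. *)
Definition even_odd_pos (m : nat) (i : 'I_(m + m)) : 'I_(2 * m) :=
  match split i with inl j => even_pos j | inr j => odd_pos j end.

(** Parity separates the two halves, and doubling is injective on each. *)
Lemma odd_even_pos_inj (m : nat) : injective (odd_even_pos m).
Proof.
move=> i j; rewrite /odd_even_pos => /(congr1 val).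
by case: (split_ordP i) => a ->; case: (split_ordP j) => b ->;
  rewrite ?(unsplitK (inl _)) ?(unsplitK (inr _)) /=;
  [move=> E; congr lshift | move/(congr1 odd) | move/(congr1 odd)
  | move=> E; congr rshift]; rewrite /= ?mul2n ?odd_double //;
  apply: val_inj; move: E; rewrite !mul2n; [move/double_inj | case=> /double_inj].
Qed.

Lemma even_odd_pos_inj (m : nat) : injective (even_odd_pos m).
Proof.
move=> i j; rewrite /even_odd_pos => /(congr1 val).
by case: (split_ordP i) => a ->; case: (split_ordP j) => b ->;
  rewrite ?(unsplitK (inl _)) ?(unsplitK (inr _)) /=;
  [move=> E; congr lshift | move/(congr1 odd) | move/(congr1 odd)
  | move=> E; congr rshift]; rewrite /= ?mul2n ?odd_double //;
  apply: val_inj; move: E; rewrite !mul2n; [case=> /double_inj | move/double_inj].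
Qed.

Theorem corollary1p4 (R : comPzRingType) (m : nat) (hm : (0 < m)%N)
  (A : 'M[R]_(2 * m)) (hskew : skew_symmetric A)
  (hzero : forall (i j : 'I_(2 * m)) (q : nat),
     (2 <= q)%N -> (i.+1 + j.+1 = 2 * q)%N -> A i j = 0) :
  permanent A = (-1) ^+ m * permanent (even_odd_submx A) ^+ 2 /\
  \det A = \det (even_odd_submx A) ^+ 2.
Proof.
set C := even_odd_submx A.
pose X : 'M[R]_m := \matrix_(i, j) A (odd_pos i) (odd_pos j).
have eq_mm : (m + m = 2 * m)%N by rewrite mul2n addnn.
have even0 (i j : 'I_m) : A (even_pos i) (even_pos j) = 0.
  (* The 1-based indices are [2 * i.+1] and [2 * j.+1], whose sum is [2 * (i + j).+2]. *)
  apply: (hzero _ _ (i + j).+2) => //=.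
  by rewrite !mulnS mulnDr !addSn !addnS.
split.
  rewrite -(permanent_mxsub _ _ _ (odd_even_pos m) (even_odd_pos m) A eq_mm
    (@odd_even_pos_inj m) (@even_odd_pos_inj m)).
  (* The corner is written as a scalar multiple so that [permanentZ] extracts [(-1) ^+ m]. *)
  have -> : mxsub (odd_even_pos m) (even_odd_pos m) A
          = block_mx (-1 *: C^T) X 0 C.
    apply/matrixP => i j; rewrite mxE /odd_even_pos /even_odd_pos.
    case: (split_ordP i) => a ->; case: (split_ordP j) => b ->;
      rewrite ?(unsplitK (inl _)) ?(unsplitK (inr _)) ?block_mxEul
        ?block_mxEur ?block_mxEdl ?block_mxEdr !mxE ?even0 //.
    by rewrite mulN1r; exact: hskew.
  by rewrite permanent_ublock permanentZ permanent_tr -mulrA -expr2.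
rewrite -(det_mxsub _ _ _ (odd_even_pos m) A eq_mm (@odd_even_pos_inj m)).
have -> : mxsub (odd_even_pos m) (odd_even_pos m) A = block_mx X (- C^T) C 0.
  apply/matrixP => i j; rewrite mxE /odd_even_pos.
  case: (split_ordP i) => a ->; case: (split_ordP j) => b ->;
    rewrite ?(unsplitK (inl _)) ?(unsplitK (inr _)) ?block_mxEul
      ?block_mxEur ?block_mxEdl ?block_mxEdr !mxE ?even0 //.
by rewrite det_antiblock opprK det_tr -expr2.
Qed.
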